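(* Let $A\in\mathbb M_m$ be a Perron-like matrix with principal eigenvalue $s=s(A)$, let $\delta>0$ be such that $\mathrm{Re}\,\mu\le s-2\delta$ for all $\mu\in\sigma(A)\setminus\{s\}$, and let $V=[v_i]_{i\in J}\in\mathbb M_m$ be nonsingular with $\|V\|=1$. For $n\in\mathbb N$ let $T_n=\sum_{k=0}^n\frac1{k!}A^k$, and define $$M_n(0)=V,\qquad M_n(k+1)=\frac{T_nM_n(k)}{\|T_nM_n(k)\|}\quad(k\in\mathbb N).$$ Let $W_n=M_n(n)$, $\lambda=2e^{2\|A\|}$, and let $q(t)$ and $\Xi$ be the matrices defined in the context. Then there exist positive constants $B_0,B_1,B_2$ such that, for $n\in\mathbb N$ (with $T_nM_n(k)\ne0$ for $0\le k<n$, so that $W_n$ is defined; and $n\ge1$ in the last two estimates), $$\|W_n-q(n)\|\le B_0e^{-\delta n}+\left(\frac{\lambda\|A\|}{n+1}\right)^{n+1}o(1),$$ $$\|W_n-\Xi\|\le O(n^{-1})+B_1e^{-\delta n}+\left(\frac{\lambda\|A\|}{n+1}\right)^{n+1}o(1),$$ $$\left|\langle AW_n,W_n\rangle-s\right|\le O(n^{-1})+B_2e^{-\delta n}+\|A\|\left(\frac{\lambda\|A\|}{n+1}\right)^{n+1}o(1),$$ where $o(1)$ is an infinitesimal as $n\to\infty$ depending only upon $n$.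
   Context: $J=\{1,\dots,m\}$; $\mathbb N$ is the set of nonnegative integers. $\mathbb M_m$ is the space of real $m\times m$ matrices; $[\alpha_i]_{i\in J}$ denotes the matrix with columns $\alpha_i$. $\mathbb R^m$ carries the Euclidean inner product and norm; on $\mathbb M_m$, $\langle[\alpha_i],[\beta_i]\rangle=\sum_{i\in J}\langle\alpha_i,\beta_i\rangle$ and $\|M\|=\langle M,M\rangle^{1/2}$. $\sigma(A)$ is the set of (complex) eigenvalues of $A$, $s(A)=\max\{\mathrm{Re}\,\mu:\mu\in\sigma(A)\}$. $A$ is Perron-like if $s:=s(A)\in\sigma(A)$ and $\mathrm{Re}\,\mu<s$ for all $\mu\in\sigma(A)\setminus\{s\}$; $s$ is then called the principal eigenvalue. $\mathrm{GE}_s(A)=\{\xi\in\mathbb R^m:(A-sI)^k\xi=0\text{ for some }k\ge1\}$. For any $\mu\in\sigma(A)$, $\mathrm{GE}_\mu(A)\subset\mathbb R^m$ is the set of all real and imaginary parts of vectors $u\in\mathbb C^m$ with $(A-\mu I)^ku=0$ for some $k\ge1$. Then $\mathbb R^m=E_1\oplus E_2$ with $E_1=\mathrm{GE}_s(A)$, $E_2=\sum_{\mu\in\sigma(A)\setminus\{s\}}\mathrm{GE}_\mu(A)$, and $\Pi_1$ is the projection onto $E_1$ along $E_2$. The cyclic order $\nu=\mathrm{Cord}(\mathrm{GE}_s(A))$ is the smallest $\nu\ge1$ with $(A-sI)^\nu\mathrm{GE}_s(A)=\{0\}$. Put $y_i=\Pi_1v_i$, $Y=[y_i]_{i\in J}$,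 $Q_{y_i}(t)=e^{t(A-sI)}y_i=\sum_{k=0}^{\nu-1}\frac{t^k}{k!}(A-sI)^ky_i$, $Q_Y(t)=[Q_{y_i}(t)]_{i\in J}$, and $q(t)=Q_Y(t)/\|Q_Y(t)\|$. Put $w_i=\frac1{(\nu-1)!}(A-sI)^{\nu-1}y_i$, $\omega=(\sum_{i\in J}\|w_i\|^2)^{1/2}$ (which is positive), $\xi_i=\omega^{-1}w_i$, $\Xi=[\xi_i]_{i\in J}$. $O(n^{-1})$ denotes a quantity bounded by $Cn^{-1}$ with $C>0$ independent of $n$. *)

(* Defs.v *)
From HB Require Import structures.
From mathcomp Require Import all_boot all_order all_algebra.
From mathcomp Require Import complex.
From mathcomp Require Import all_classical all_reals all_analysis.

Set Implicit Arguments.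
Unset Strict Implicit.
Unset Printing Implicit Defensive.

Import Order.TTheory GRing.Theory Num.Theory numFieldNormedType.Exports.

Local Open Scope classical_set_scope.
Local Open Scope ring_scope.

Section Defs.
Variables (R : realType) (m : nat).
Implicit Types (A B M V : 'M[R]_m) (s t : R) (mu : R[i]) (n k : nat).

(* The Euclidean structure on matrices is defined by hand: the norm that
   MathComp-Analysis puts on matrices is the maximum norm. *)
Definition vdot (x y : 'cV[R]_m) : R := \sum_(k < m) x k 0 * y k 0.

Definition mdot A B : R := \sum_(i < m) vdot (col i A) (col i B).

Definition vnorm (x : 'cV[R]_m) : R := Num.sqrt (vdot x x).

Definition mnorm A : R := Num.sqrt (mdot A A).

Definition mx_of_cols (f : 'I_m -> 'cV[R]_m) : 'M[R]_m :=
  \matrix_(k, i) f i k 0.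

Definition complexify p q (A : 'M[R]_(p, q)) : 'M[R[i]]_(p, q) :=
  map_mx (real_complex R) A.

(* [eigenvalue] is about row vectors, whence the transpose. *)
Definition spectrum A : set R[i] :=
  [set mu | eigenvalue (complexify A)^T mu].

(* The supremum is a maximum when [0 < m], the spectrum being finite. *)
Definition spectral_abscissa A : R :=
  sup [set complex.Re mu | mu in spectrum A].

Definition perron_like A : Prop :=
  let s := spectral_abscissa A in
  spectrum A (real_complex R s) /\
  forall mu, spectrum A mu -> mu != real_complex R s -> complex.Re mu < s.

Definition GE_real A s : set 'cV[R]_m :=
  [set x | exists k, (1 <= k)%N /\ (A - s%:M) ^+ k *m x = 0].

Definition GE A mu : set 'cV[R]_m :=
  [set x | exists (u : 'cV[R[i]]_m) (k : nat),
     [/\ (1 <= k)%N, (complexify A - mu%:M) ^+ k *m u = 0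
       & x = map_mx (@complex.Re R) u \/ x = map_mx (@complex.Im R) u]].

Definition E1 A : set 'cV[R]_m := GE_real A (spectral_abscissa A).

Definition E2 A : set 'cV[R]_m :=
  let S := spectrum A `\ real_complex R (spectral_abscissa A) in
  [set x | exists f : R[i] -> 'cV[R]_m,
     (forall mu, S mu -> GE A mu (f mu)) /\ x = \sum_(mu \in S) f mu].

(* The component of [x] in [F1] along [F2], meaningful when the space is the
   direct sum of [F1] and [F2]. *)
Definition proj_along (F1 F2 : set 'cV[R]_m) (x : 'cV[R]_m) : 'cV[R]_m :=
  xget 0 [set y | F1 y /\ F2 (x - y)].

Definition Pi1 A : 'cV[R]_m -> 'cV[R]_m := proj_along (E1 A) (E2 A).

Definition is_cyclic_order A s (nu : nat) : Prop :=
  let annihilates k :=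
    [set (A - s%:M) ^+ k *m x | x in GE_real A s] = [set 0] in
  [/\ (1 <= nu)%N, annihilates nu
    & forall k, (1 <= k)%N -> annihilates k -> (nu <= k)%N].

Definition Cord A s : nat := xget 1%N [set nu | is_cyclic_order A s nu].

Definition expm M : 'M[R]_m :=
  limn (series (fun k => (k`!%:R)^-1 *: M ^+ k) : nat -> 'M[R]_m).

Definition yvec A V (i : 'I_m) : 'cV[R]_m := Pi1 A (col i V).

Definition Qvec A (y : 'cV[R]_m) t : 'cV[R]_m :=
  expm (t *: (A - (spectral_abscissa A)%:M)) *m y.

Definition QY A V t : 'M[R]_m := mx_of_cols (fun i => Qvec A (yvec A V i) t).

Definition q A V t : 'M[R]_m := (mnorm (QY A V t))^-1 *: QY A V t.

Definition wvec A V (i : 'I_m) : 'cV[R]_m :=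
  let s := spectral_abscissa A in
  let nu := Cord A s in
  ((nu.-1)`!%:R)^-1 *: ((A - s%:M) ^+ nu.-1 *m yvec A V i).

Definition omega A V : R :=
  Num.sqrt (\sum_(i < m) vnorm (wvec A V i) ^+ 2).

Definition Xi A V : 'M[R]_m :=
  mx_of_cols (fun i => (omega A V)^-1 *: wvec A V i).

Definition T A n : 'M[R]_m := \sum_(k < n.+1) (k`!%:R)^-1 *: A ^+ k.

Fixpoint iterM A V n k : 'M[R]_m :=
  if k is k'.+1 then
    (mnorm (T A n *m iterM A V n k'))^-1 *: (T A n *m iterM A V n k')
  else V.

Definition W A V n : 'M[R]_m := iterM A V n n.

Definition W_defined A V n : Prop :=
  forall k, (k < n)%N -> T A n *m iterM A V n k != 0.

Definition lambda A : R := 2 * expR (2 * mnorm A).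

End Defs.

Definition O_inv_n (R : realType) (r : nat -> R) : Prop :=
  exists C : R, 0 < C /\ forall n : nat, (1 <= n)%N -> `|r n| <= C * n%:R^-1.

(* Main.v *)
Require Import Defs.
From HB Require Import structures.
From mathcomp Require Import all_boot all_order all_algebra.
From mathcomp Require Import complex.
From mathcomp Require Import all_classical all_reals all_analysis.
From mathcomp Require Import ring lra.

(* The error term [o] can be taken to be zero: for fixed [A] the Taylor remainder
   [T_n ^ n - e ^ (n A)] is smaller than every exponential, so that it is absorbed
   in the term [B0 * e ^ (- delta n)].

   Up to normalization [W_n] is [e ^ (- s n) T_n ^ n V], hence is exponentially
   close to [e ^ (n N) V] with [N = A - s].  Write [V = Y + Z] with [Y = Pi1 V].
   The columns of [Z] are sums of real and imaginary parts of generalized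
   eigenvectors for eigenvalues of [N] of real part at most [-2 delta], so that
   [e ^ (n N) Z] is [O(e ^ (- delta n))].  On the other hand [e ^ (n N) Y] is a
   polynomial in [n] with leading coefficient [w <> 0]; it is bounded below for
   large [n], and its direction is that of [w] up to [O(1 / n)]. *)

Set Implicit Arguments.
Unset Strict Implicit.
Unset Printing Implicit Defensive.

Import Order.TTheory GRing.Theory Num.Theory numFieldNormedType.Exports.

Local Open Scope classical_set_scope.
Local Open Scope ring_scope.

(** * Partial sums of the exponential series *)

Lemma cauchy_triangle (K : pzRingType) (a b : nat -> K) N :
  \sum_(k < N) \sum_(i < k.+1) a i * b (k - i)%N
  = \sum_(i < N) a i * \sum_(j < N - i) b j.
Proof.
elim: N => [|N IH]; first by rewrite !big_ord0.
rewrite big_ord_recr /= IH [RHS]big_ord_recr /= subSnn big_ord1.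
rewrite [X in _ + X]big_ord_recr /= subnn addrA -big_split /=.
congr (_ + _); apply: eq_bigr => i _.
by rewrite subSn ?(ltnW (ltn_ord i)) // big_ord_recr /= mulrDr.
Qed.

(** What remains are the products with [i + j >= N]. Each can be bounded termwise, so the defect is
    monotone in the sizes of the terms. *)
Lemma cauchy_defect (K : pzRingType) (a b : nat -> K) N :
  (\sum_(i < N) a i) * (\sum_(j < N) b j)
    - \sum_(k < N) \sum_(i < k.+1) a i * b (k - i)%N
  = \sum_(i < N) a i * \sum_(N - i <= j < N) b j.
Proof.
rewrite cauchy_triangle mulr_suml -sumrB; apply: eq_bigr => i _.
rewrite -mulrBr; congr (_ * _); rewrite -!(big_mkord xpredT b).
by rewrite (big_cat_nat (leq0n (N - i)) (leq_subr i N)) /= addrAC subrr add0r.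
Qed.

Section ExpPartialSums.
Variables (F : numFieldType) (K : algType F).
Implicit Types x y : K.

(** Stated over an arbitrary algebra so as to serve real and complex matrices, and also the scalars,
    as algebras [R^o] and [R[i]^o] over themselves. *)
Definition expc x k : K := (k`!%:R)^-1 *: x ^+ k.

Definition expS x n : K := \sum_(k < n) expc x k.

Lemma expcD x y k : GRing.comm x y ->
  expc (x + y) k = \sum_(i < k.+1) expc x i * expc y (k - i).
Proof.
move=> xy; rewrite /expc addrC exprDn_comm; last exact: commr_sym.
rewrite scaler_sumr; apply: eq_bigr => i _.
have ik : (i <= k)%N by rewrite -ltnS.
rewrite -scalerAl -scalerAr scalerA -(commrX _ (commr_sym (commrX _ (commr_sym xy)))).
rewrite -[_ *+ 'C(k, i)](@scaler_nat F) scalerA; congr (_ *: _).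
rewrite -(bin_fact ik) !natrM !invfM.
have n0 j : (j`!%:R : F) != 0 by rewrite pnatr_eq0 -lt0n fact_gt0.
have b0 : ('C(k, i)%:R : F) != 0 by rewrite pnatr_eq0 -lt0n bin_gt0.
by field; rewrite !n0 b0.
Qed.

Lemma expS_defect x y n : GRing.comm x y ->
  expS x n * expS y n - expS (x + y) n
  = \sum_(i < n) expc x i * \sum_(n - i <= j < n) expc y j.
Proof.
move=> xy; rewrite -cauchy_defect; congr (_ - _).
by apply: eq_bigr => k _; rewrite expcD.
Qed.

Lemma expSD x y n : GRing.comm x y ->
  expS (x + y) n = \sum_(i < n) expc x i * expS y (n - i).
Proof.
by move=> xy; rewrite -cauchy_triangle; apply: eq_bigr => k _; rewrite expcD.
Qed.

End ExpPartialSums.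

Lemma expcZ (F : numFieldType) (K : algType F) (c : F) (x : K) k :
  expc (c *: x) k = expc (c : F^o) k *: x ^+ k.
Proof. by rewrite /expc exprZn scalerA. Qed.

Lemma expS_scalar (F : numFieldType) (m : nat) (c : F) n :
  expS (c%:M : 'M[F]_m.+1) n = (expS (c : F^o) n)%:M.
Proof.
rewrite /expS raddf_sum; apply: eq_bigr => k _ /=.
by rewrite -scalemx1 expcZ expr1n scalemx1.
Qed.

Section RealExp.
Variable R : realType.
Implicit Types x y : R.

Lemma expcR_ge0 x k : 0 <= x -> 0 <= expc (x : R^o) k.
Proof. by move=> x0; rewrite mulr_ge0 ?invr_ge0 ?exprn_ge0. Qed.

Lemma expSR_series x n : expS (x : R^o) n = series (exp_coeff x) n.
Proof.
rewrite /expS /series /= big_mkord; apply: eq_bigr => k _.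
by rewrite /exp_coeff /= mulrC.
Qed.

Lemma cvg_expSR x : expS (x : R^o) n @[n --> \oo] --> expR x.
Proof.
rewrite (_ : (fun n => _) = series (exp_coeff x)).
  exact: is_cvg_series_exp_coeff.
by apply/funext => n; exact: expSR_series.
Qed.

Lemma expSR_le x n : 0 <= x -> expS (x : R^o) n <= expR x.
Proof.
move=> x0; rewrite expSR_series; apply: nondecreasing_cvgn_le.
  by apply: nondecreasing_series => k _ _; exact: exp_coeff_ge0.
exact: is_cvg_series_exp_coeff.
Qed.

Lemma cvg_expSR_defect x y :
  expS (x : R^o) n * expS (y : R^o) n - expS (x + y : R^o) n @[n --> \oo]
  --> (0 : R).
Proof.
rewrite -(subrr (expR (x + y))) {1}expRD.
by apply: cvgB; [apply: cvgM|]; exact: cvg_expSR.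
Qed.

End RealExp.

Section NormedDefect.
Variables (R : realType) (F : numFieldType) (K : algType F) (nrm : K -> R).
Hypothesis nrm0 : nrm 0 = 0.
Hypothesis nrm_ge0 : forall x, 0 <= nrm x.
Hypothesis nrmD : forall x y, nrm (x + y) <= nrm x + nrm y.
Hypothesis nrmM : forall x y, nrm (x * y) <= nrm x * nrm y.
Implicit Types x y : K.

Lemma nrm_sum (I : Type) (r : seq I) (P : pred I) (f : I -> K) :
  nrm (\sum_(i <- r | P i) f i) <= \sum_(i <- r | P i) nrm (f i).
Proof.
elim/big_rec2: _ => [|i a b _ ab]; first by rewrite nrm0.
by rewrite (le_trans (nrmD _ _)) // lerD2l.
Qed.

(** Bounding each factor of each product in the defect by its real counterpart gives the real
    defect, which tends to 0. The constant [c] makes room for a norm in which the identity has norm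
    greater than 1. *)
Lemma expS_defect_le x y n (c u v : R) : GRing.comm x y ->
  (forall k, nrm (expc x k) <= c * expc (u : R^o) k) ->
  (forall k, nrm (expc y k) <= c * expc (v : R^o) k) ->
  nrm (expS x n * expS y n - expS (x + y) n)
  <= c ^+ 2 * (expS (u : R^o) n * expS (v : R^o) n - expS (u + v : R^o) n).
Proof.
move=> xy xu yv; rewrite expS_defect // expS_defect; last exact: mulrC.
rewrite (le_trans (nrm_sum _ _ _)) // mulr_sumr; apply: ler_sum => i _.
rewrite (le_trans (nrmM _ _)) // expr2 mulrACA.
apply: ler_pM => //; rewrite (le_trans (nrm_sum _ _ _)) // mulr_sumr.
by apply: ler_sum => j _.
Qed.

End NormedDefect.

(** * The Frobenius norm *)

(** By Lagrange's identity, twice the difference of the two sides is a double sum of squares. *)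
Lemma sum_CauchySchwarz (R : realDomainType) (I : finType) (a b : I -> R) :
  (\sum_i a i * b i) ^+ 2 <= (\sum_i a i ^+ 2) * (\sum_i b i ^+ 2).
Proof.
have: 0 <= \sum_i \sum_j (a i * b j - a j * b i) ^+ 2.
  by apply: sumr_ge0 => i _; apply: sumr_ge0 => j _; exact: sqr_ge0.
have -> : \sum_i \sum_j (a i * b j - a j * b i) ^+ 2
    = ((\sum_i a i ^+ 2) * (\sum_i b i ^+ 2) - (\sum_i a i * b i) ^+ 2) *+ 2.
  rewrite mulrnBl [X in X - _]mulr2n {1}[_ * \sum_i b i ^+ 2]mulr_suml.
  rewrite [(\sum_i a i ^+ 2) * _]mulrC [(\sum_i b i ^+ 2) * _]mulr_suml.
  rewrite expr2 mulr_suml -sumrMnl -big_split -sumrB /=; apply: eq_bigr => i _.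
  rewrite !mulr_sumr -sumrMnl -big_split -sumrB /=; apply: eq_bigr => j _.
  by ring.
by rewrite pmulrn_lge0 // subr_ge0.
Qed.

Section FrobeniusNorm.
Variables (R : realType) (m : nat).
Implicit Types (A B C : 'M[R]_m) (c : R).

Lemma mdotE A B : mdot A B = \sum_(ij : 'I_m * 'I_m) A ij.2 ij.1 * B ij.2 ij.1.
Proof.
rewrite -(pair_bigA _ (fun i k => A k i * B k i)) /=.
apply: eq_bigr => i _; rewrite /vdot.
by apply: eq_bigr => k _; rewrite !mxE.
Qed.

Lemma mdotC A B : mdot A B = mdot B A.
Proof. by rewrite !mdotE; apply: eq_bigr => i _; rewrite mulrC. Qed.

Lemma mdotDl A B C : mdot (A + B) C = mdot A C + mdot B C.
Proof.
by rewrite !mdotE -big_split; apply: eq_bigr => i _; rewrite mxE mulrDl.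
Qed.

Lemma mdotZl c A B : mdot (c *: A) B = c * mdot A B.
Proof. by rewrite !mdotE mulr_sumr; apply: eq_bigr => i _; rewrite mxE mulrA. Qed.

Lemma mdotDr A B C : mdot A (B + C) = mdot A B + mdot A C.
Proof. by rewrite mdotC mdotDl ![mdot _ A]mdotC. Qed.

Lemma mdotZr c A B : mdot A (c *: B) = c * mdot A B.
Proof. by rewrite mdotC mdotZl mdotC. Qed.

Lemma mdotBl A B C : mdot (A - B) C = mdot A C - mdot B C.
Proof. by rewrite mdotDl -scaleN1r mdotZl mulN1r. Qed.

Lemma mdotBr A B C : mdot A (B - C) = mdot A B - mdot A C.
Proof. by rewrite mdotC mdotBl ![mdot _ A]mdotC. Qed.

Lemma mdotAA_ge0 A : 0 <= mdot A A.
Proof. by rewrite mdotE; apply: sumr_ge0 => i _; rewrite -expr2 sqr_ge0. Qed.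

Lemma mnorm_ge0 A : 0 <= mnorm A. Proof. exact: sqrtr_ge0. Qed.

Lemma sqr_mnorm A : mnorm A ^+ 2 = mdot A A.
Proof. by rewrite sqr_sqrtr // mdotAA_ge0. Qed.

Lemma sqr_mnormE A : mnorm A ^+ 2 = \sum_i \sum_k A k i ^+ 2.
Proof.
rewrite sqr_mnorm; apply: eq_bigr => i _; apply: eq_bigr => k _.
by rewrite !mxE expr2.
Qed.

Lemma mdot_le A B : `|mdot A B| <= mnorm A * mnorm B.
Proof.
rewrite -ler_sqr ?nnegrE ?mulr_ge0 ?mnorm_ge0 // real_normK ?num_real //.
rewrite exprMn !sqr_mnorm !mdotE; exact: sum_CauchySchwarz.
Qed.

Lemma mnorm0 : mnorm (0 : 'M[R]_m) = 0.
Proof.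
by apply/eqP; rewrite -sqrf_eq0 sqr_mnorm -[0 in X in mdot X _](scale0r 0) mdotZl mul0r.
Qed.

Lemma mnormZ c A : mnorm (c *: A) = `|c| * mnorm A.
Proof.
rewrite /mnorm mdotZl mdotZr mulrA -expr2 sqrtrM ?sqr_ge0 //.
by rewrite sqrtr_sqr.
Qed.

Lemma mnormN A : mnorm (- A) = mnorm A.
Proof. by rewrite -scaleN1r mnormZ normrN1 mul1r. Qed.

Lemma mnormD A B : mnorm (A + B) <= mnorm A + mnorm B.
Proof.
rewrite -ler_sqr ?nnegrE ?addr_ge0 ?mnorm_ge0 // sqrrD !sqr_mnorm.
rewrite mdotDl !mdotDr [mdot B A]mdotC.
have := le_trans (ler_norm _) (mdot_le A B); lra.
Qed.

Lemma mnormB A B : mnorm (A - B) <= mnorm A + mnorm B.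
Proof. by rewrite (le_trans (mnormD _ _)) // mnormN. Qed.

Lemma mnorm_distC A B : mnorm (A - B) = mnorm (B - A).
Proof. by rewrite -mnormN opprB. Qed.

Lemma mnorm_distD C A B : mnorm (A - B) <= mnorm (A - C) + mnorm (C - B).
Proof. by rewrite -[A in leLHS](subrK C) -addrA mnormD. Qed.

Lemma mnorm_ge_dist A B : `|mnorm A - mnorm B| <= mnorm (A - B).
Proof.
rewrite ler_norml; apply/andP; split.
  have := mnormD (B - A) A; rewrite subrK mnorm_distC; lra.
by have := mnormD (A - B) B; rewrite subrK; lra.
Qed.

Lemma mnorm_entry A i j : `|A i j| <= mnorm A.
Proof.
rewrite -ler_sqr ?nnegrE ?mnorm_ge0 // real_normK ?num_real // sqr_mnormE.
rewrite (bigD1 j) //= (bigD1 i) //= -addrA lerDl.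
apply: addr_ge0; apply: sumr_ge0 => k _; first exact: sqr_ge0.
by apply: sumr_ge0 => l _; exact: sqr_ge0.
Qed.

Lemma mnorm_eq0 A : (mnorm A == 0) = (A == 0).
Proof.
apply/eqP/eqP => [A0|->]; last exact: mnorm0.
apply/matrixP => i j; rewrite mxE; apply/eqP; rewrite -normr_le0.
by rewrite -A0 mnorm_entry.
Qed.

Lemma mnorm_gt0 A : (0 < mnorm A) = (A != 0).
Proof. by rewrite lt_def mnorm_ge0 mnorm_eq0 andbT. Qed.

Lemma mnorm_le_entries A c :
  (forall i j, `|A i j| <= c) -> mnorm A <= m%:R * c.
Proof.
(* Without entries [c] might be negative, so the empty matrix is treated apart. *)
move=> Ac; case: (posnP m) => [m0|m_gt0].
  suff -> : A = 0 by rewrite mnorm0 m0 mul0r.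
  by apply/matrixP => i; have := ltn_ord i; rewrite [X in (_ < X)%N]m0.
have c0 : 0 <= c by apply: le_trans (Ac (Ordinal m_gt0) (Ordinal m_gt0)).
rewrite -ler_sqr ?nnegrE ?mnorm_ge0 ?mulr_ge0 // sqr_mnormE exprMn.
have <- : \sum_(i < m) \sum_(k < m) c ^+ 2 = m%:R ^+ 2 * c ^+ 2.
  by rewrite !sumr_const !card_ord -!mulrnA -natrX mulr_natl mulnn.
apply: ler_sum => i _; apply: ler_sum => k _.
by rewrite -real_normK ?num_real // ler_sqr ?nnegrE.
Qed.

(** Cauchy-Schwarz applied to every entry of the product. *)
Lemma mnormM A B : mnorm (A *m B) <= mnorm A * mnorm B.
Proof.
rewrite -ler_sqr ?nnegrE ?mulr_ge0 ?mnorm_ge0 // exprMn !sqr_mnormE.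
rewrite [X in X * _]exchange_big mulrC mulr_suml /=; apply: ler_sum => i _.
rewrite mulr_sumr; apply: ler_sum => k _.
by rewrite mxE mulrC sum_CauchySchwarz.
Qed.

Lemma mx_norm_le_mnorm A : `|A| <= mnorm A.
Proof.
rewrite [`|A|]mx_normrE; apply: (big_ind (fun x => x <= mnorm A)) => [|x y ? ?|[i j] _].
- exact: mnorm_ge0.
- by rewrite ge_max; apply/andP.
- exact: mnorm_entry.
Qed.

End FrobeniusNorm.

(** * Normalized matrices *)

Section Normalization.
Variables (R : realType) (m : nat).
Implicit Types (X Y : 'M[R]_m) (c : R).

(** As the inverse of 0 is 0, [nml 0] is 0, and the norm of [nml X] is at most 1 in every case. *)
Definition nml X := (mnorm X)^-1 *: X.

Lemma nmlZ c X : 0 < c -> nml (c *: X) = nml X.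
Proof.
move=> c0; rewrite /nml mnormZ gtr0_norm // scalerA; congr (_ *: _).
by rewrite invfM mulrAC mulVf ?gt_eqF // mul1r.
Qed.

Lemma mnorm_nml X : X != 0 -> mnorm (nml X) = 1.
Proof.
move=> X0; rewrite mnormZ ger0_norm ?invr_ge0 ?mnorm_ge0 //.
by rewrite mulVf // mnorm_eq0.
Qed.

Lemma mnorm_nml_le1 X : mnorm (nml X) <= 1.
Proof.
have [->|/mnorm_nml ->//] := eqVneq X 0.
by rewrite /nml scaler0 mnorm0.
Qed.

(** Intermediate normalizations cancel, so that the iteration reduces to one normalization of a
    matrix power. *)
Lemma nml_mull B X : nml (B *m nml X) = nml (B *m X).
Proof.
have [->|X0] := eqVneq X 0; first by rewrite /nml scaler0 mulmx0.
by rewrite {2}/nml -scalemxAr nmlZ // invr_gt0 mnorm_gt0.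
Qed.

(** Pass through [X] divided by [mnorm Y]: replacing the divisor and then the numerator each costs
    at most [mnorm (X - Y) / mnorm Y]. *)
Lemma nml_dist X Y : Y != 0 -> mnorm (nml X - nml Y) <= 2 * mnorm (X - Y) / mnorm Y.
Proof.
move=> Y0; have nY : 0 < mnorm Y by rewrite mnorm_gt0.
rewrite (le_trans (mnorm_distD ((mnorm Y)^-1 *: X) _ _)) //.
rewrite [nml Y]/nml -scalerBr mnormZ -scalerBl mnormZ.
rewrite [`|(mnorm Y)^-1|]ger0_norm ?invr_ge0 ?mnorm_ge0 //.
suff H : `|(mnorm X)^-1 - (mnorm Y)^-1| * mnorm X <= (mnorm Y)^-1 * mnorm (X - Y).
  by lra.
have [->|X0] := eqVneq X 0.
  by rewrite mnorm0 mulr0 mulr_ge0 ?invr_ge0 ?mnorm_ge0.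
have nX : 0 < mnorm X by rewrite mnorm_gt0.
rewrite -{2}(gtr0_norm nX) -normrM.
have -> : ((mnorm X)^-1 - (mnorm Y)^-1) * mnorm X
    = - ((mnorm Y)^-1 * (mnorm X - mnorm Y)).
  by field; rewrite !gt_eqF.
rewrite normrN normrM [`|(mnorm Y)^-1|]gtr0_norm ?invr_gt0 //.
by rewrite ler_pM2l ?invr_gt0 // mnorm_ge_dist.
Qed.

End Normalization.

(** * The matrix exponential *)

Section MatrixLimits.
Variables (R : realType) (m : nat).
Implicit Types (U : nat -> 'M[R]_m) (L M X : 'M[R]_m).

(** Convergence in the Frobenius norm; [mcvg_cvg] transfers it to the maximum norm, in which the
    limit defining [expm] is taken. *)
Definition mcvg U L := mnorm (U n - L) @[n --> \oo] --> (0 : R).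

Lemma mcvg0_le (u : nat -> R) U L : (\forall n \near \oo, mnorm (U n - L) <= u n) ->
  u n @[n --> \oo] --> (0 : R) -> mcvg U L.
Proof.
move=> Uu u0; apply: (@squeeze_cvgr _ \oo _ _ (fun=> 0) u) => //; last exact: cvg_cst.
by apply: filterS Uu => n ->; rewrite mnorm_ge0.
Qed.

Lemma mcvg_entries U L :
  (forall i j, U n i j @[n --> \oo] --> L i j) -> mcvg U L.
Proof.
move=> UL; apply/cvgr0Pnorm_lt => e e0.
(* Dividing by [m.+1] keeps the final inequality strict and covers [m = 0]. *)
have em : 0 < e / m.+1%:R by rewrite divr_gt0.
have H : \forall n \near \oo, forall i j, `|L i j - U n i j| < e / m.+1%:R.
  apply: filter_forall => i; apply: filter_forall => j.
  by move/cvgrPdist_lt: (UL i j); apply.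
apply: filterS H => n H; rewrite ger0_norm ?mnorm_ge0 //.
have /mnorm_le_entries/le_lt_trans : forall i j, `|(U n - L) i j| <= e / m.+1%:R.
  by move=> i j; rewrite !mxE distrC ltW.
apply; rewrite mulrCA gtr_pMr // ltr_pdivrMr // mul1r ltr_nat //.
Qed.

Lemma mcvg_cvg U L : mcvg U L -> U n @[n --> \oo] --> L.
Proof.
move=> UL; apply/subr_cvg0/norm_cvg0P.
apply: (@squeeze_cvgr _ \oo _ _ (fun=> 0) (fun n => mnorm (U n - L))) => //.
- by near=> n; rewrite normr_ge0 mx_norm_le_mnorm.
- exact: cvg_cst.
Unshelve. all: by end_near. Qed.

Lemma mcvg_dist_le U L X b :
  mcvg U L -> (\forall n \near \oo, mnorm (U n - X) <= b) -> mnorm (L - X) <= b.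
Proof.
move=> UL UX; suff : mnorm (L - X) <= 0 + b by rewrite add0r.
have H : mnorm (U n - L) + b @[n --> \oo] --> 0 + b by apply: cvgD; [|exact: cvg_cst].
apply: (cvgr_to_ge H).
apply: filterS UX => n UX; rewrite (le_trans (mnorm_distD (U n) _ _)) //.
by rewrite mnorm_distC lerD2l.
Qed.

Lemma mcvg_unique U L L' : mcvg U L -> mcvg U L' -> L = L'.
Proof.
move=> UL UL'; apply/eqP; rewrite -subr_eq0 -mnorm_eq0 eq_le mnorm_ge0 andbT.
apply/ler_addgt0Pl => e e0; rewrite addr0; apply: (mcvg_dist_le UL).
move/cvgr0Pnorm_lt : UL' => /(_ e e0); apply: filterS => n.
by rewrite ger0_norm ?mnorm_ge0 // => /ltW.
Qed.

Lemma mcvgM U U' L L' : mcvg U L -> mcvg U' L' ->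
  mcvg (fun n => U n *m U' n) (L *m L').
Proof.
move=> UL UL'; pose a n := mnorm (U n - L); pose b n := mnorm (U' n - L').
apply: (@mcvg0_le (fun n => a n * (mnorm L' + b n) + mnorm L * b n)).
  near=> n; rewrite (le_trans (mnorm_distD (L *m U' n) _ _)) // -mulmxBl -mulmxBr.
  rewrite lerD ?(le_trans (mnormM _ _)) // ler_wpM2l ?mnorm_ge0 //.
  by rewrite -[U' n in leLHS](subrK L') addrC mnormD.
rewrite -[X in _ --> X](_ : 0 * (mnorm L' + 0) + mnorm L * 0 = 0);
  last by rewrite mul0r mulr0 addr0.
apply: cvgD; apply: cvgM => //; last exact: cvg_cst.
by apply: cvgD => //; exact: cvg_cst.
Unshelve. all: by end_near. Qed.

End MatrixLimits.

Section MatrixExp.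
Variables (R : realType) (m : nat).
Implicit Types (M X Y : 'M[R]_m.+1).

Lemma mnorm1_ge1 : 1 <= mnorm (1 : 'M[R]_m.+1).
Proof.
by have := mnorm_entry (1 : 'M[R]_m.+1) 0 0; rewrite !mxE eqxx normr1.
Qed.

(** The factor [mnorm 1], the square root of the size, accounts for the power 0. *)
Lemma mnormX M k : mnorm (M ^+ k) <= mnorm (1 : 'M[R]_m.+1) * mnorm M ^+ k.
Proof.
elim: k => [|k IH]; first by rewrite !expr0 mulr1.
by rewrite !exprSr mulrA (le_trans (mnormM _ _)) // ler_wpM2r // mnorm_ge0.
Qed.

Lemma mnorm_expc M k : mnorm (expc M k)
  <= mnorm (1 : 'M[R]_m.+1) * expc (mnorm M : R^o) k.
Proof.
rewrite mnormZ ger0_norm // [leRHS]mulrCA.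
by rewrite ler_wpM2l // mnormX.
Qed.

(** Every entry of the series converges absolutely by comparison with the real exponential series at
    [mnorm M]; the matrix of the entrywise limits is then the limit [expm M]. *)
Lemma mcvg_expm M : mcvg (expS M) (expm M).
Proof.
pose L := \matrix_(i, j) limn (series (fun k => expc M k i j)).
have ML : mcvg (expS M) L.
  apply: mcvg_entries => i j.
  rewrite mxE (_ : (fun n => _) = series (fun k => expc M k i j)); last first.
    by apply/funext => n; rewrite /series /= summxE big_mkord.
  apply: normed_cvg.
  apply: (@series_le_cvg _ _
    (mnorm (1 : 'M[R]_m.+1) *: (exp_coeff (mnorm M) : R ^nat))) => //.
  - by move=> n; exact: normr_ge0.
  - by move=> n; exact: (mulr_ge0 (mnorm_ge0 _) (exp_coeff_ge0 n (mnorm_ge0 _))).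
  - move=> n; have := mnorm_expc M n.
    rewrite (_ : expc _ n = exp_coeff (mnorm M) n); last by rewrite /exp_coeff /= mulrC.
    exact: le_trans (mnorm_entry _ _ _).
  - exact/is_cvg_seriesZ/is_cvg_series_exp_coeff.
suff -> : expm M = L by [].
apply: cvg_lim; first exact: norm_hausdorff.
rewrite (_ : series _ = expS M); first exact: mcvg_cvg.
by apply/funext => n; rewrite /series /= big_mkord.
Qed.

(** The product of the partial sums tends to the right-hand side, and its distance to the partial
    sum at [X + Y] is dominated by a real defect, which tends to 0. *)
Lemma expmD X Y : GRing.comm X Y -> expm (X + Y) = expm X *m expm Y.
Proof.
move=> XY; apply: (mcvg_unique (@mcvg_expm (X + Y))).
have XYE := mcvgM (@mcvg_expm X) (@mcvg_expm Y).
pose c := mnorm (1 : 'M[R]_m.+1).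
pose d n := expS (mnorm X : R^o) n * expS (mnorm Y : R^o) n
  - expS (mnorm X + mnorm Y : R^o) n.
apply: (@mcvg0_le _ _
  (fun n => c ^+ 2 * d n + mnorm (expS X n *m expS Y n - expm X *m expm Y))).
  near=> n; rewrite (le_trans (mnorm_distD (expS X n *m expS Y n) _ _)) //.
  rewrite lerD2r mnorm_distC.
  apply: (@expS_defect_le _ _ 'M[R]_m.+1 (@mnorm R m.+1) (@mnorm0 _ _)
    (@mnorm_ge0 _ _) (@mnormD _ _) (@mnormM _ _)) => //; exact: mnorm_expc.
rewrite -[X in _ --> X](_ : c ^+ 2 * 0 + 0 = 0); last by rewrite mulr0 addr0.
apply: cvgD => //; apply: cvgM; first exact: cvg_cst.
exact: cvg_expSR_defect.
Unshelve. all: by end_near. Qed.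

Lemma expm0 : expm (0 : 'M[R]_m.+1) = 1.
Proof.
apply: (mcvg_unique (@mcvg_expm 0)).
apply: (@mcvg0_le _ _ (fun=> 0)); last exact: cvg_cst.
near=> n; rewrite -(prednK (_ : (0 < n)%N)); last by near: n; exact: nbhs_infty_gt.
rewrite /expS big_ord_recl big1 => [|k _].
  by rewrite /expc expr0 invr1 scale1r addr0 subrr mnorm0.
by rewrite /expc expr0n /= scaler0.
Unshelve. all: by end_near. Qed.

Lemma expm_natZ M n : expm (n%:R *: M) = expm M ^+ n.
Proof.
elim: n => [|n IH]; first by rewrite scale0r expm0 expr0.
rewrite -natr1 scalerDl scale1r expmD ?IH ?exprSr //.
by apply: commr_sym; rewrite /GRing.comm -scalerAl -scalerAr.
Qed.

Lemma expmDscalar M (c : R) : expm (M + c%:M) = expR c *: expm M.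
Proof.
rewrite expmD; last exact: comm_mx_scalar.
suff -> : expm (c%:M : 'M[R]_m.+1) = (expR c)%:M by rewrite mul_mx_scalar.
apply: (mcvg_unique (@mcvg_expm c%:M)).
apply: mcvg_entries => i j.
under eq_fun do rewrite expS_scalar mxE.
rewrite mxE; case: (i == j); last exact: cvg_cst.
exact: cvg_expSR.
Qed.

End MatrixExp.

(** * Partial exponential sums at a complex number *)

Section ComplexExp.
Variable R : realType.
Import ComplexField.Normc.
Implicit Types z : R[i].

Lemma normc_conj z : normc (conjc z) = normc z.
Proof. by case: z => a b; rewrite /= sqrrN. Qed.

Lemma normc_real (x : R) : normc (real_complex R x) = `|x|.
Proof. by rewrite /= expr0n /= addr0 sqrtr_sqr. Qed.

Lemma normc_ge0 z : 0 <= normc z.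
Proof. by case: z => a b; exact: sqrtr_ge0. Qed.

Lemma Re_le_normc z : `|complex.Re z| <= normc z.
Proof.
by case: z => a b /=; rewrite -sqrtr_sqr ler_wsqrtr // lerDl sqr_ge0.
Qed.

Lemma Im_le_normc z : `|complex.Im z| <= normc z.
Proof.
by case: z => a b /=; rewrite -sqrtr_sqr ler_wsqrtr // lerDr sqr_ge0.
Qed.

Lemma normc_expc z k : normc (expc (z : R[i]^o) k) = expc (normc z : R^o) k.
Proof.
rewrite /expc normcM normcV -[k`!%:R](rmorph_nat (real_complex R)) normc_real.
rewrite normr_nat; congr (_ * _); elim: k => [|k IH]; first by rewrite normc1.
by rewrite !exprS normcM IH.
Qed.

Lemma expS_conj z n : expS (conjc z : R[i]^o) n = conjc (expS (z : R[i]^o) n).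
Proof.
rewrite /expS [RHS](rmorph_sum (@conjc R)) /=; apply: eq_bigr => k _.
by rewrite /expc [RHS]rmorphM rmorphXn fmorphV rmorph_nat.
Qed.

Lemma expS_real (x : R) n :
  expS (real_complex R x : R[i]^o) n = real_complex R (expS (x : R^o) n).
Proof.
rewrite /expS [RHS](rmorph_sum (real_complex R)) /=; apply: eq_bigr => k _.
by rewrite /expc [RHS]rmorphM rmorphXn fmorphV rmorph_nat.
Qed.

(* [|S_n(z)|^2 = S_n(z) S_n(z^* )] is close to [S_n(2 Re z)], which tends to
   [e^(2 Re z)]. *)
Lemma normc_expS_le z : \forall n \near \oo,
  normc (expS (z : R[i]^o) n) <= 2 * expR (complex.Re z).
Proof.
set a := complex.Re z; set r := normc z.
pose u n := `|expS (2 * a : R^o) n|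
  + 1 ^+ 2 * (expS (r : R^o) n * expS (r : R^o) n - expS (r + r : R^o) n).
have u_cvg : u n @[n --> \oo] --> `|expR (2 * a)| + 1 ^+ 2 * 0.
  apply: cvgD; first by apply: cvg_norm; exact: cvg_expSR.
  by apply: cvgM; [exact: cvg_cst | exact: cvg_expSR_defect].
(* The factor 2 in the bound leaves strict room above the limit of [u], so that [u n] is eventually
   below it. *)
have u_lt : `|expR (2 * a)| + 1 ^+ 2 * 0 < (2 * expR a) ^+ 2.
  rewrite mulr0 addr0 ger0_norm ?expR_ge0 // mulr_natl mulr2n expRD exprMn -expr2.
  by rewrite ltr_pMl ?exprn_gt0 ?expR_gt0 // -natrX ltr1n.
near=> n; have un : u n < (2 * expR a) ^+ 2.
  by near: n; exact: cvgr_lt u_cvg _ u_lt.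
rewrite -ler_sqr ?nnegrE ?normc_ge0 ?mulr_ge0 ?expR_ge0 //.
apply: le_trans (ltW un).
rewrite expr2 -{2}normc_conj -normcM -expS_conj.
rewrite -[_ * _ in leLHS](subrK (expS (z + conjc z : R[i]^o) n)) addrC.
rewrite (le_trans (le_normcD _ _)) // lerD //.
  rewrite (_ : z + conjc z = real_complex R (2 * a)) ?expS_real ?normc_real //.
  by rewrite addcJ rmorphM rmorph_nat.
apply: (@expS_defect_le R _ R[i]^o (@normc R) (@normc0 R) normc_ge0 (@le_normcD R)).
- by move=> x y; rewrite normcM.
- exact: mulrC.
- by move=> k; rewrite mul1r normc_expc.
- by move=> k; rewrite mul1r normc_expc normc_conj.
Unshelve. all: by end_near. Qed.

End ComplexExp.

(** * Generalized eigenspaces *)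

Section PrimaryDecomposition.
Variables (F : fieldType) (m : nat).
Implicit Types (A : 'M[F]_m.+1) (mu : F) (p q : {poly F}).

Lemma horner_mx_XsubCX A mu k :
  horner_mx A (('X - mu%:P) ^+ k) = (A - mu%:M) ^+ k.
Proof. by rewrite rmorphXn rmorphB /= horner_mx_X horner_mx_C. Qed.

Lemma horner_mxM A p q : horner_mx A (p * q) = horner_mx A p *m horner_mx A q.
Proof. exact: rmorphM. Qed.

Lemma coprimep_XsubC_prod mu (rs : seq F) (k : F -> nat) l : mu \notin rs ->
  coprimep (('X - mu%:P) ^+ l) (\prod_(nu <- rs) ('X - nu%:P) ^+ k nu).
Proof.
move=> mu_rs; apply: coprimep_expl; elim: rs mu_rs => [|nu rs IH].
  by rewrite big_nil coprimep1.
rewrite in_cons negb_or big_cons coprimepMr => /andP[mu_nu /IH ->].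
by rewrite andbT coprimep_expr // coprimep_XsubC2 // subr_eq0 eq_sym.
Qed.

(** With [a p + b r = 1], the vector splits into [(a p)(A) u], killed by [r(A)] and handled by
    induction, and [(b r)(A) u], killed by [p(A)]. *)
Lemma primary_decomposition A (rs : seq F) (k : F -> nat) (u : 'cV[F]_m.+1) :
  uniq rs ->
  horner_mx A (\prod_(mu <- rs) ('X - mu%:P) ^+ k mu) *m u = 0 ->
  exists f : F -> 'cV[F]_m.+1,
    (forall mu, mu \in rs -> (A - mu%:M) ^+ k mu *m f mu = 0)
    /\ u = \sum_(mu <- rs) f mu.
Proof.
elim: rs u => [|mu rs IH] u /=.
  rewrite big_nil rmorph1 mul1mx => _ ->.
  by exists (fun=> 0); split => [//|]; rewrite big_nil.
move=> /andP[mu_rs uniq_rs]; rewrite big_cons.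
set p := ('X - _) ^+ _; set r := \prod_(_ <- _) _ => pru.
have /Bezout_eq1_coprimepP[[a b] /= ab1] : coprimep p r.
  exact: coprimep_XsubC_prod.
have [|f [f_rs fE]] := IH (horner_mx A (a * p) *m u) uniq_rs.
  rewrite mulmxA -horner_mxM mulrCA [r * _]mulrC horner_mxM.
  by rewrite -mulmxA pru mulmx0.
exists (fun nu => if nu == mu then horner_mx A (b * r) *m u else f nu); split.
  move=> nu; rewrite in_cons; case: eqVneq => [-> _|_ /=]; last exact: f_rs.
  rewrite -horner_mx_XsubCX mulmxA -horner_mxM -/p mulrCA horner_mxM.
  by rewrite -mulmxA pru mulmx0.
rewrite big_cons eqxx (eq_big_seq f); last first.
  by move=> nu nu_rs; case: eqVneq nu_rs mu_rs => // -> ->.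
by rewrite -fE -mulmxDl -rmorphD /= addrC ab1 rmorph1 mul1mx.
Qed.

Lemma char_poly_tr A : char_poly A^T = char_poly A.
Proof.
rewrite /char_poly -[RHS]det_tr; congr (\det _).
by rewrite /char_poly_mx linearB /= tr_scalar_mx map_trmx.
Qed.

End PrimaryDecomposition.

(** * Generalized eigenspaces of a real matrix *)

Section GeneralizedEigenspaces.
Variables (R : realType) (m : nat).
Implicit Types (A N : 'M[R]_m.+1) (x y : 'cV[R]_m.+1) (s : R) (mu : R[i]).
Implicit Types (u : 'cV[R[i]]_m.+1).

Lemma spectrumP A mu : spectrum A mu <-> root (char_poly (complexify A)) mu.
Proof. by rewrite /spectrum /= eigenvalue_root_char char_poly_tr. Qed.

Lemma spectrum_seq A : exists2 r : seq R[i],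
  (forall mu, spectrum A mu <-> mu \in r) &
  char_poly (complexify A) = \prod_(z <- r) ('X - z%:P).
Proof.
have [r rE] := closed_field_poly_normal (char_poly (complexify A)).
rewrite (monicP (char_poly_monic _)) scale1r in rE.
by exists r => // mu; rewrite -root_prod_XsubC -rE; exact: spectrumP.
Qed.

Lemma complexify_XsubC A s k :
  (complexify A - (real_complex R s)%:M) ^+ k = complexify ((A - s%:M) ^+ k).
Proof. by rewrite [RHS]rmorphXn /= map_mxB map_scalar_mx. Qed.

Section Parts.
Variable part : R[i] -> R.
Hypothesis partD : forall z w, part (z + w) = part z + part w.
Hypothesis partZ : forall (c : R) z, part (real_complex R c * z) = c * part z.

Let part0 : part 0 = 0.
Proof. by have := partZ 0 0; rewrite mulr0 mul0r. Qed.

Lemma part_sum (I : Type) (r : seq I) (P : pred I) (f : I -> R[i]) :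
  part (\sum_(i <- r | P i) f i) = \sum_(i <- r | P i) part (f i).
Proof. by elim/big_rec2: _ => // i a b _ <-; rewrite partD. Qed.

Lemma map_part_sum (I : Type) (r : seq I) (f : I -> 'cV[R[i]]_m.+1) :
  map_mx part (\sum_(i <- r) f i) = \sum_(i <- r) map_mx part (f i).
Proof.
apply/matrixP => i j; rewrite mxE !summxE part_sum.
by apply: eq_bigr => k _; rewrite mxE.
Qed.

(** Here [part] stands for the real or the imaginary part; only its linearity over the reals
    matters. *)
Lemma map_part_mul A u : map_mx part (complexify A *m u) = A *m map_mx part u.
Proof.
apply/matrixP => i j; rewrite !mxE part_sum.
by apply: eq_bigr => k _; rewrite !mxE partZ.
Qed.

End Parts.

Lemma ReD (z w : R[i]) : complex.Re (z + w) = complex.Re z + complex.Re w.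
Proof. by case: z w => [a b] [c d]. Qed.

Lemma ImD (z w : R[i]) : complex.Im (z + w) = complex.Im z + complex.Im w.
Proof. by case: z w => [a b] [c d]. Qed.

Lemma ReZ (c : R) (z : R[i]) : complex.Re (real_complex R c * z) = c * complex.Re z.
Proof. by case: z => a b /=; rewrite mul0r subr0. Qed.

Lemma ImZ (c : R) (z : R[i]) : complex.Im (real_complex R c * z) = c * complex.Im z.
Proof. by case: z => a b /=; rewrite mul0r addr0. Qed.

(** [Pi1] picks some splitting, so it is enough that one exists. The complexified vector is
    decomposed along the characteristic polynomial, which kills it by Cayley-Hamilton, and real
    parts are taken. *)
Lemma Pi1_spec A x : spectrum A (real_complex R (spectral_abscissa A)) ->
  E1 A (Pi1 A x) /\ E2 A (x - Pi1 A x).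
Proof.
set s := spectral_abscissa A => s_spec.
suff : [set y | E1 A y /\ E2 A (x - y)] (Pi1 A x) by [].
apply: xgetPex.
have [r specE rE] := spectrum_seq A.
(* With multiplicities as exponents, the product over the distinct roots is the characteristic
   polynomial. *)
pose k mu := count_mem mu r.
have [|f [fK fE]] := @primary_decomposition _ _ (complexify A) (undup r) k
    (map_mx (real_complex R) x) (undup_uniq r).
  rewrite (_ : \prod_(_ <- _) _ = char_poly (complexify A)).
    by rewrite Cayley_Hamilton mul0mx.
  rewrite rE -[RHS]big_undup_iterop_count; exact: eq_bigr.
have k_gt0 mu : mu \in undup r -> (1 <= k mu)%N.
  by rewrite mem_undup -has_pred1 has_count.
have s_r : real_complex R s \in undup r by rewrite mem_undup; apply/specE.
pose g mu := map_mx (@complex.Re R) (f mu).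
have xE : x = \sum_(mu <- undup r) g mu.
  rewrite -(map_part_sum ReD ReZ) -fE; apply/matrixP => i j.
  by rewrite !mxE.
exists (g (real_complex R s)); split.
  exists (k (real_complex R s)); split; first exact: k_gt0.
  rewrite -(map_part_mul ReD ReZ) -complexify_XsubC fK //.
  by apply/matrixP => i j; rewrite !mxE.
exists g; split => [mu [/specE mu_r /= mu_s]|].
  exists (f mu), (k mu); split; [|apply: fK|by left].
    by apply: k_gt0; rewrite mem_undup.
  by rewrite mem_undup.
rewrite xE (bigD1_seq (real_complex R s)) ?undup_uniq //= addrAC subrr add0r.
rewrite -big_filter fsbig_seq ?filter_uniq ?undup_uniq //.
apply: eq_fsbigl; apply/seteqP; split => mu /=.
  rewrite mem_filter mem_undup => /andP[mu_s mu_r].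
  by split; [apply/specE | apply/eqP].
move=> [/specE mu_r /eqP mu_s]; rewrite mem_filter mem_undup mu_r andbT //.
Qed.

(** A single exponent for all vectors: the multiplicity [a] of [s]. Write the characteristic
    polynomial as [h (X - s)^a] and [1 = b (X - s)^k + c h]; applied to [(A - s)^a x], the first
    term vanishes by the choice of [k], the second by Cayley-Hamilton. *)
Lemma GE_real_exponent A s : exists a : nat, forall x,
  GE_real A s x -> (A - s%:M) ^+ a *m x = 0.
Proof.
have [a [h]] := multiplicity_XsubC (char_poly A) s.
rewrite monic_neq0 ?char_poly_monic //= => hs chE; exists a => x [k [_ xk]].
have /Bezout_eq1_coprimepP[[b c] /= bc1] : coprimep (('X - s%:P) ^+ k) h.
  by apply: coprimep_expl; rewrite coprimep_sym coprimep_XsubC.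
have bcE : horner_mx A (b * ('X - s%:P) ^+ k + c * h) = 1%:M by rewrite bc1 rmorph1.
rewrite -[_ *m x]mul1mx -bcE rmorphD /= mulmxDl.
rewrite -!(horner_mx_XsubCX A s a) !mulmxA -!horner_mxM.
rewrite -!mulrA -chE [_ ^+ k * _]mulrC [b * _]mulrA [c * _]mulrC.
rewrite !horner_mxM Cayley_Hamilton !mul0mx addr0.
by rewrite (horner_mx_XsubCX A s k) -!mulmxA xk !mulmx0.
Qed.

(** The characteristic polynomial of [A] already has the real root [s], so the eigenvector can be
    taken real. The transposes turn row eigenvectors into columns. *)
Lemma eigenvector_exists A s : spectrum A (real_complex R s) ->
  exists2 x : 'cV[R]_m.+1, x != 0 & (A - s%:M) *m x = 0.
Proof.
move=> /spectrumP; rewrite -map_char_poly fmorph_root -char_poly_tr.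
rewrite -eigenvalue_root_char => /eigenvalueP[v vA v0]; exists v^T.
  by rewrite trmx_eq0.
apply: trmx_inj; rewrite trmx_mul trmxK linearB /= tr_scalar_mx mulmxBr vA.
by rewrite mul_mx_scalar subrr trmx0.
Qed.

(** A smallest exponent exists by [GE_real_exponent]; its minimality provides a vector not killed by
    the preceding power. *)
Lemma Cord_spec A s : spectrum A (real_complex R s) ->
  [/\ (0 < Cord A s)%N,
      forall x, GE_real A s x -> (A - s%:M) ^+ Cord A s *m x = 0 &
      exists2 x, GE_real A s x & (A - s%:M) ^+ (Cord A s).-1 *m x != 0].
Proof.
move=> s_spec; set N := A - s%:M.
pose ann k := [set N ^+ k *m x | x in GE_real A s] = [set 0].
have GE0 : GE_real A s 0 by exists 1%N; rewrite mulmx0.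
have annP k : ann k <-> forall x, GE_real A s x -> N ^+ k *m x = 0.
  split=> [annk x xs|annk].
    by have : [set N ^+ k *m x | x in GE_real A s] (N ^+ k *m x) by [exists x];
      rewrite annk.
  apply/seteqP; split => [_ [x xs <-]|_ ->]; first exact: annk.
  by exists 0 => //; rewrite mulmx0.
have [a aP] := GE_real_exponent A s.
have ex : exists k, `[< (1 <= k)%N /\ ann k >].
  exists a.+1; apply/asboolP; split => //; apply/annP => x xs.
  by rewrite exprS -mulmxA aP // mulmx0.
have : is_cyclic_order A s (Cord A s).
  apply: xgetPex; case: (ex_minnP ex) => n /asboolP[n1 ann_n] n_min.
  by exists n; split => // k k1 annk; apply: n_min; apply/asboolP.
case: (Cord A s) => [[] //|n [_ /annP annn n_min]]; split => //=.
(* For cyclic order 1 the preceding power is the identity and minimality, which concerns exponents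
   at least 1, says nothing; an eigenvector serves. *)
have [n0|n_gt0] := posnP n.
  have [x x0 xs] := eigenvector_exists s_spec.
  exists x; last by rewrite n0 expr0 mul1mx.
  by exists 1%N; rewrite expr1.
apply: contrapT => no_x; have : ann n.
  apply/annP => x xs; apply/eqP; apply: contrapT => /negP xn.
  by apply: no_x; exists x.
by move/(n_min _ n_gt0); rewrite ltnn.
Qed.

End GeneralizedEigenspaces.

(** * Growth of the matrix exponential *)

Section ExpGrowth.
Variables (R : realType) (m : nat).
Implicit Types (A M N Y : 'M[R]_m.+1) (x : 'cV[R]_m.+1) (mu : R[i]).
Import ComplexField.Normc.

Lemma expcR_le (x : R) k : 0 <= x -> expc (x : R^o) k <= expR x.
Proof.
move=> x0; apply: le_trans (expSR_le k.+1 x0); rewrite /expS big_ord_recr /=.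
by rewrite lerDr sumr_ge0 // => i _; exact: expcR_ge0.
Qed.

Lemma complexify_expS M n : complexify (expS M n) = expS (complexify M) n.
Proof.
rewrite /complexify /expS map_mx_sum; apply: eq_bigr => k _.
by rewrite /expc map_mxZ fmorphV rmorph_nat -rmorphXn.
Qed.

Lemma cvg_mulmx_col (U : nat -> 'M[R]_m.+1) L x i : mcvg U L ->
  (U n *m x) i 0 @[n --> \oo] --> (L *m x) i 0.
Proof.
(* [mcvg] concerns square matrices, so the column is repeated to form one. *)
move=> UL; pose X : 'M[R]_m.+1 := \matrix_(k, j) x k 0.
have XE M : (M *m x) i 0 = (M *m X) i i.
  by rewrite !mxE; apply: eq_bigr => k _; rewrite mxE.
have UX : mcvg (fun n => U n *m X) (L *m X).
  apply: mcvgM => //; apply: (@mcvg0_le _ _ (fun=> 0)); last exact: cvg_cst.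
  by near=> n; rewrite subrr mnorm0.
apply/subr_cvg0/norm_cvg0P; apply: (@squeeze_cvgr _ \oo _ _ (fun=> 0) _ _ _ _ _ UX).
  near=> n; rewrite normr_ge0 /= !XE.
  by have := mnorm_entry (U n *m X - L *m X) i i; rewrite !mxE.
exact: cvg_cst.
Unshelve. all: by end_near. Qed.

Section Decay.
Variable part : R[i] -> R.
Hypothesis partD : forall z w, part (z + w) = part z + part w.
Hypothesis partZ : forall (c : R) z, part (real_complex R c * z) = c * part z.
Hypothesis part_le : forall z, `|part z| <= normc z.

(** From [t N = t (N - mu) + t mu]: on a generalized eigenvector only finitely many powers of
    [N - mu] survive. Working with partial sums avoids a complex exponential. *)
Lemma complexify_shift_expS N mu (t : R) n :
  expS (complexify (t *: N)) n
  = \sum_(j < n) (expc (real_complex R t : R[i]^o) j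
      * expS (real_complex R t * mu : R[i]^o) (n - j)) *:
      (complexify N - mu%:M) ^+ j.
Proof.
have -> : complexify (t *: N) = real_complex R t *: (complexify N - mu%:M)
    + (real_complex R t * mu)%:M.
  by rewrite /complexify map_mxZ scalerBr scale_scalar_mx subrK.
rewrite expSD; last exact: comm_mx_scalar.
apply: eq_bigr => j _; rewrite expS_scalar expcZ -scalerAl.
by rewrite -[LHS]/(_ *: (_ *m _)) mul_mx_scalar scalerA.
Qed.

(** The bound is proved for the partial sums and passes to the limit. The terms [j < k] have size at
    most [t^j / j!] times [2 e^(t Re mu)] times [w j i], and the polynomial factor is absorbed by
    [(e t)^j / j! <= exp(e t)]. *)
Lemma generalized_eigenvector_decay N mu k (u : 'cV[R[i]]_m.+1) (e : R) :
  (complexify N - mu%:M) ^+ k *m u = 0 -> 0 < e ->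
  exists2 C, 0 <= C & forall n i,
    `|(expm (n%:R *: N) *m map_mx part u) i 0|
    <= C * expR ((complex.Re mu + e) * n%:R).
Proof.
move=> uk e0; set P := complexify N - mu%:M.
pose w j i := normc ((P ^+ j *m u) i 0).
have w_ge0 j i : 0 <= w j i by exact: normc_ge0.
exists (\sum_(j < k) 2 * (e ^+ j)^-1 * \sum_i w j i).
  apply: sumr_ge0 => j _; rewrite !mulr_ge0 ?invr_ge0 ?exprn_ge0 ?sumr_ge0 //.
  exact: ltW.
move=> n i; set t : R := n%:R.
have t0 : 0 <= t by exact: ler0n.
apply: (@le_trans _ _
    (\sum_(j < k) expc (t : R^o) j * (2 * expR (t * complex.Re mu)) * w j i));
    last first.
  rewrite mulr_suml; apply: ler_sum => j _.
  have -> : 2 * (e ^+ j)^-1 * (\sum_i0 w j i0) * expR ((complex.Re mu + e) * t)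
      = ((e ^+ j)^-1 * expR (e * t)) * (2 * expR (t * complex.Re mu))
        * \sum_i0 w j i0.
    by rewrite [(complex.Re mu + e) * t]mulrDl expRD [complex.Re mu * t]mulrC; ring.
  apply: ler_pM => //.
  - by rewrite !mulr_ge0 ?expR_ge0 ?invr_ge0 ?exprn_ge0.
  - rewrite ler_wpM2r ?mulr_ge0 ?expR_ge0 //.
    rewrite ler_pdivlMl ?exprn_gt0 //.
    have := @expcR_le (e * t) j (mulr_ge0 (ltW e0) t0).
    by rewrite /expc exprMn /GRing.scale /= mulrCA.
  - by rewrite (bigD1 i) //= lerDl sumr_ge0.
have [M0 _ HM0] := normc_expS_le (real_complex R t * mu).
have cvgU := cvg_mulmx_col (x := map_mx part u) (i := i) (@mcvg_expm R m (t *: N)).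
apply: (cvgr_to_le (cvg_norm cvgU)).
(* Beyond this index [M - j] is past [M0] for all [j < k], so the bound on partial sums applies to
   each surviving term. *)
exists (M0 + k)%N => // M /= M0M.
have kM : (k <= M)%N by exact: leq_trans (leq_addl _ _) M0M.
rewrite -(map_part_mul partD partZ) complexify_expS.
rewrite (complexify_shift_expS N mu) mulmx_suml.
rewrite mxE summxE (le_trans (part_le _)) //.
rewrite (le_trans (nrm_sum (K := R[i]^o) (@normc0 R) (@le_normcD R) _ _ _)) //.
rewrite (big_ord_widen M (fun j => expc (t : R^o) j
  * (2 * expR (t * complex.Re mu)) * w j i)) // [leRHS]big_mkcond /=.
apply: ler_sum => j _; rewrite -scalemxAl mxE normcM normcM normc_expc normc_real.
rewrite ger0_norm //; case: ltnP => jk.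
  rewrite ler_wpM2r ?normc_ge0 // ler_wpM2l ?expcR_ge0 //.
  have := HM0 (M - j)%N; rewrite /= ReZ; apply.
  by rewrite leq_subRL ?(leq_trans (ltnW jk)) // addnC (leq_trans _ M0M) //
     leq_add2l ltnW.
suff -> : (complexify N - mu%:M) ^+ j *m u = 0 by rewrite mxE normc0 mulr0.
by rewrite -(subnK jk) exprD -mulmxA uk mulmx0.
Qed.

End Decay.

Definition decays N (e : R) x := exists2 C, 0 <= C &
  forall n i, `|(expm (n%:R *: N) *m x) i 0| <= C * expR (- e * n%:R).

Lemma decays0 N e : decays N e 0.
Proof. by exists 0 => // n i; rewrite mulmx0 mxE normr0 mul0r. Qed.

Lemma decays_sum N e (I : Type) (r : seq I) (f : I -> 'cV[R]_m.+1) :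
  (forall i, decays N e (f i)) -> decays N e (\sum_(i <- r) f i).
Proof.
move=> fr; apply: big_ind => //; first exact: decays0.
move=> x y [C C0 xC] [D D0 yD]; exists (C + D); first exact: addr_ge0.
move=> n i; rewrite mulmxDr mxE mulrDl (le_trans (ler_normD _ _)) //.
exact: lerD.
Qed.

(** Shifting by [s] brings the real parts to at most [-2 delta]; one [delta] is spent on the
    polynomial factors, the other remains as rate. *)
Lemma E2_decays A delta x : let s := spectral_abscissa A in 0 < delta ->
  (forall mu, spectrum A mu -> mu != real_complex R s ->
     complex.Re mu <= s - 2 * delta) ->
  E2 A x -> decays (A - s%:M) delta x.
Proof.
move=> s d0 gap [f [fGE ->]].
have fd mu : spectrum A mu -> mu != real_complex R s ->
    decays (A - s%:M) delta (f mu).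
  move=> mu_spec mu_s.
  have [u [k [_ uk fE]]] : GE A mu (f mu) by apply: fGE; split => //; exact/eqP.
  set nu := mu - real_complex R s.
  have {}uk : (complexify (A - s%:M) - nu%:M) ^+ k *m u = 0.
    rewrite /complexify map_mxB map_scalar_mx raddfB /= opprB addrA subrK.
    exact: uk.
  have nu_le : complex.Re nu + delta <= - delta.
    rewrite /nu ReD; have := gap mu mu_spec mu_s.
    by rewrite [complex.Re (- _)]/=; lra.
  have le_exp n C : 0 <= C -> C * expR ((complex.Re nu + delta) * n%:R)
      <= C * expR (- delta * n%:R).
    by move=> C0; rewrite ler_wpM2l // ler_expR ler_wpM2r.
  case: fE => ->.
    have [C C0 HC] := generalized_eigenvector_decay (@ReD R) (@ReZ R)
      (@Re_le_normc R) uk d0.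
    by exists C => // n i; rewrite (le_trans (HC _ _)) // le_exp.
  have [C C0 HC] := generalized_eigenvector_decay (@ImD R) (@ImZ R)
    (@Im_le_normc R) uk d0.
  by exists C => // n i; rewrite (le_trans (HC _ _)) // le_exp.
(* The sum over the set runs over its finite support, and is 0 by convention when the support is
   infinite. *)
case: finite_supportP => [_|X XS _ _]; first by rewrite big_nil; exact: decays0.
rewrite big_seq big_mkcond; apply: decays_sum => mu; case: ifP => [muX|_].
  have [mu_spec /eqP mu_s] := XS _ muX; exact: fd.
exact: decays0.
Qed.

Lemma expm_nilpotent N Y nu (t : R) : N ^+ nu *m Y = 0 ->
  expm (t *: N) *m Y = \sum_(k < nu) expc (t : R^o) k *: (N ^+ k *m Y).
Proof.
move=> NY.
have UL : mcvg (fun n => expS (t *: N) n *m Y) (expm (t *: N) *m Y).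
  apply: mcvgM; first exact: mcvg_expm.
  apply: (@mcvg0_le _ _ (fun=> 0)); last exact: cvg_cst.
  by near=> n; rewrite subrr mnorm0.
apply: (mcvg_unique UL); apply: (@mcvg0_le _ _ (fun=> 0)); last exact: cvg_cst.
exists nu => // n /= nu_n.
rewrite (big_ord_widen n (fun k => expc (t : R^o) k *: (N ^+ k *m Y))) //.
rewrite big_mkcond mulmx_suml -sumrB big1 ?mnorm0 // => k _.
rewrite expcZ -scalemxAl; case: ltnP => [_|nuk]; first by rewrite subrr.
by rewrite -(subnK nuk) exprD -mulmxA NY mulmx0 scaler0 subr0.
Unshelve. all: by end_near. Qed.

(** The exponential is a polynomial in [n] here; after division by [n^p] each term of degree [k < p]
    is at most its coefficient over [n]. *)
Lemma expm_leading_term N Y p : N ^+ p.+1 *m Y = 0 ->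
  exists2 C, 0 <= C & forall n, (1 <= n)%N ->
    mnorm ((n%:R ^+ p)^-1 *: (expm (n%:R *: N) *m Y)
           - (p`!%:R)^-1 *: (N ^+ p *m Y)) <= C / n%:R.
Proof.
move=> NY; exists (\sum_(k < p) mnorm ((k`!%:R)^-1 *: (N ^+ k *m Y))).
  by apply: sumr_ge0 => k _; exact: mnorm_ge0.
move=> n n1; have n0 : 0 < n%:R :> R by rewrite ltr0n.
rewrite (expm_nilpotent _ NY) big_ord_recr /= scalerDr scalerA.
have -> : (n%:R ^+ p)^-1 * expc (n%:R : R^o) p = (p`!%:R)^-1.
  by rewrite /expc /GRing.scale /= mulrCA mulVf ?mulr1 // expf_neq0 // gt_eqF.
rewrite addrK scaler_sumr mulr_suml.
apply: (le_trans (nrm_sum (K := 'M[R]_m.+1) (@mnorm0 _ _) (@mnormD _ _) _ _ _)).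
apply: ler_sum => k _; rewrite !scalerA !mnormZ.
rewrite [leRHS]mulrAC ler_wpM2r ?mnorm_ge0 //.
rewrite /expc /GRing.scale /= mulrCA normrM ler_wpM2l //.
rewrite ger0_norm ?mulr_ge0 ?invr_ge0 ?exprn_ge0 ?(ltW n0) //.
rewrite ler_pdivrMl ?exprn_gt0 // ler_pdivlMr // -exprSr.
by rewrite ler_weXn2l // ler1n.
Qed.

Lemma mnorm_expS M n :
  mnorm (expS M n) <= mnorm (1 : 'M[R]_m.+1) * expR (mnorm M).
Proof.
apply: (le_trans (nrm_sum (K := 'M[R]_m.+1) (@mnorm0 _ _) (@mnormD _ _) _ _ _)).
apply: (@le_trans _ _ (mnorm (1 : 'M[R]_m.+1) * expS (mnorm M : R^o) n)).
  by rewrite mulr_sumr; apply: ler_sum => k _; exact: mnorm_expc.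
by rewrite ler_wpM2l ?mnorm_ge0 // expSR_le // mnorm_ge0.
Qed.

Lemma mnorm_expm M : mnorm (expm M) <= mnorm (1 : 'M[R]_m.+1) * expR (mnorm M).
Proof.
rewrite -[expm M]subr0; apply: (mcvg_dist_le (@mcvg_expm _ _ M)).
by near=> n; rewrite subr0 mnorm_expS.
Unshelve. all: by end_near. Qed.

(** For [i >= n] one has [1 <= r^i / r^n], which turns the tail at [mnorm M] into one at
    [r * mnorm M]. The parameter [r] stays free, to beat any geometric growth. *)
Lemma expm_tail M n (r : R) : 1 <= r ->
  mnorm (expm M - expS M n)
  <= mnorm (1 : 'M[R]_m.+1) * expR (r * mnorm M) / r ^+ n.
Proof.
move=> r1; have r0 : 0 < r by exact: lt_le_trans r1.
apply: (mcvg_dist_le (@mcvg_expm _ _ M)); exists n => // k /= nk.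
rewrite /expS -!(big_mkord xpredT (expc M)) (big_cat_nat (leq0n n) nk) /=.
rewrite addrAC subrr add0r.
apply: (le_trans (nrm_sum (K := 'M[R]_m.+1) (@mnorm0 _ _) (@mnormD _ _) _ _ _)).
rewrite -mulrA.
have rM : 0 <= r * mnorm M by rewrite mulr_ge0 ?mnorm_ge0 // ltW.
apply: (@le_trans _ _ (mnorm (1 : 'M[R]_m.+1) *
    (\sum_(n <= i < k) expc (r * mnorm M : R^o) i / r ^+ n))).
  rewrite mulr_sumr big_seq [leRHS]big_seq; apply: ler_sum => i.
  rewrite mem_index_iota => /andP[ni _].
  rewrite (le_trans (mnorm_expc _ _)) // ler_wpM2l ?mnorm_ge0 //.
  rewrite ler_pdivlMr ?exprn_gt0 // /expc /GRing.scale /= exprMn -mulrA.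
  rewrite ler_wpM2l // mulrC ler_wpM2r ?exprn_ge0 ?mnorm_ge0 //.
  by rewrite ler_weXn2l.
rewrite ler_wpM2l ?mnorm_ge0 // -mulr_suml ler_wpM2r ?invr_ge0 ?exprn_ge0 ?(ltW r0) //.
apply: le_trans (expSR_le k rM).
rewrite /expS -(big_mkord xpredT (expc (r * mnorm M : R^o))).
rewrite (big_cat_nat (leq0n n) nk) /= lerDr sumr_ge0 // => i _.
exact: expcR_ge0.
Qed.

(** By induction from [X^(n+1) - Y^(n+1) = X (X^n - Y^n) + (X - Y) Y^n]; the bound on [mnorm 1]
    absorbs the extra factor of [mnormX]. *)
Lemma mnormX_dist (X Y : 'M[R]_m.+1) (L : R) n :
  mnorm (1 : 'M[R]_m.+1) <= L -> mnorm X <= L -> mnorm Y <= L ->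
  mnorm (X ^+ n - Y ^+ n) <= n%:R * L ^+ n * mnorm (X - Y).
Proof.
move=> cL XL YL; have L0 : 0 <= L by exact: le_trans (mnorm_ge0 _) XL.
have Yn k : mnorm (Y ^+ k) <= L ^+ k.+1.
  rewrite (le_trans (mnormX _ _)) // exprS ler_pM ?mnorm_ge0 ?exprn_ge0 ?mnorm_ge0 //.
  by rewrite lerXn2r ?nnegrE ?mnorm_ge0.
elim: n => [|n IH]; first by rewrite !expr0 subrr mnorm0 !mul0r.
have -> : X ^+ n.+1 - Y ^+ n.+1 = X * (X ^+ n - Y ^+ n) + (X - Y) * Y ^+ n.
  by rewrite mulrBr mulrBl -!exprS addrA subrK.
have -> : n.+1%:R * L ^+ n.+1 * mnorm (X - Y)
    = L * (n%:R * L ^+ n * mnorm (X - Y)) + mnorm (X - Y) * L ^+ n.+1.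
  by rewrite exprS -natr1; ring.
rewrite (le_trans (mnormD _ _)) // lerD // (le_trans (mnormM _ _)) //.
  by rewrite ler_pM ?mnorm_ge0.
by rewrite ler_wpM2l ?mnorm_ge0.
Qed.

End ExpGrowth.

(** * Normalized iteration *)

Section Iteration.
Variables (R : realType) (m : nat).
Implicit Types (A V Y : 'M[R]_m.+1) (y : 'I_m.+1 -> 'cV[R]_m.+1) (s delta : R).

Lemma col_mx_of_cols y i : col i (mx_of_cols y) = y i.
Proof. by apply/matrixP => k j; rewrite !mxE ord1. Qed.

Lemma mul_mx_of_cols A y : A *m mx_of_cols y = mx_of_cols (fun i => A *m y i).
Proof.
by apply/matrixP => k j; rewrite !mxE; apply: eq_bigr => l _; rewrite mxE.
Qed.

Lemma mx_of_colsZ c y : c *: mx_of_cols y = mx_of_cols (fun i => c *: y i).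
Proof. by apply/matrixP => k j; rewrite !mxE. Qed.

Lemma q_nml A V t : q A V t
  = nml (expm (t *: (A - (spectral_abscissa A)%:M)) *m mx_of_cols (yvec A V)).
Proof. by rewrite mul_mx_of_cols. Qed.

(** [omega] is the Frobenius norm of the matrix with columns [wvec A V i]. *)
Lemma Xi_nml A V : Xi A V = nml (mx_of_cols (wvec A V)).
Proof.
rewrite /Xi -mx_of_colsZ; congr (_^-1 *: _); congr (Num.sqrt _).
apply: eq_bigr => i _; rewrite col_mx_of_cols /vnorm sqr_sqrtr //.
by apply: sumr_ge0 => k _; rewrite -expr2 sqr_ge0.
Qed.

Lemma iterM_nml A V n k : mnorm V = 1 -> Defs.iterM A V n k = nml (T A n ^+ k *m V).
Proof.
move=> V1; elim: k => [|k IH] /=; first by rewrite expr0 mul1mx /nml V1 invr1 scale1r.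
by rewrite -[LHS]/(nml _) IH nml_mull mulmxA [in RHS]exprS.
Qed.

Lemma natrM_exprn_le1 (rho : R) n : 0 <= rho <= 2^-1 -> n%:R * rho ^+ n <= 1.
Proof.
move=> /andP[rho0 rho2]; apply: (@le_trans _ _ (2 ^+ n * (2^-1) ^+ n)).
  apply: ler_pM; rewrite ?exprn_ge0 //; last by rewrite lerXn2r ?nnegrE ?invr_ge0.
  by rewrite -natrX ler_nat ltnW // ltn_expl.
by rewrite -exprMn divff // expr1n.
Qed.

(* The tail of the exponential series beats [r ^ n] for every [r], in
   particular the growth rate of [T_n ^ n]. *)
Lemma taylor_pow_dist A s delta : exists2 D, 0 <= D & forall n,
  expR (- s * n%:R) * mnorm (T A n ^+ n - expm A ^+ n) <= D * expR (- delta * n%:R).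
Proof.
pose c := mnorm (1 : 'M[R]_m.+1); pose a := mnorm A; pose L := c * expR a.
have c1 : 1 <= c by exact: mnorm1_ge1.
have c0 : 0 <= c by exact: le_trans c1.
have a0 : 0 <= a by exact: mnorm_ge0.
have cL : c <= L.
  by rewrite ler_peMr // -expR0 ler_expR.
have L0 : 0 <= L by exact: le_trans cL.
(* Chosen so that [rho] below is at most 1/2, whence [n rho^n <= 1]; the summand 1 ensures
   [1 <= r]. *)
pose r := 1 + 2 * (L * expR (delta - s)).
have Le0 : 0 <= L * expR (delta - s) by rewrite mulr_ge0 ?expR_ge0.
have r1 : 1 <= r by rewrite lerDl mulr_ge0.
have r0 : 0 < r by exact: lt_le_trans r1.
pose rho := L * expR (delta - s) / r.
have rho_half : 0 <= rho <= 2^-1.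
  rewrite divr_ge0 ?(ltW r0) //= ler_pdivrMr // ler_pdivlMl //.
  by rewrite /r lerDr.
exists (c * expR (r * a)); first by rewrite mulr_ge0 ?expR_ge0.
move=> n.
have TL : mnorm (T A n) <= L by exact: mnorm_expS.
have dist : mnorm (T A n - expm A) <= c * expR (r * a) / r ^+ n.
  (* [T A n] has [n.+1] terms; the resulting [r^(n+1)] is weakened to [r^n]. *)
  rewrite mnorm_distC (le_trans (expm_tail A n.+1 r1)) // ler_wpM2l //.
    by rewrite mulr_ge0 ?expR_ge0.
  by rewrite lef_pV2 ?posrE ?exprn_gt0 // ler_weXn2l.
apply: (@le_trans _ _ 
    (expR (- s * n%:R) * (n%:R * L ^+ n * (c * expR (r * a) / r ^+ n)))).
  rewrite ler_wpM2l ?expR_ge0 // (le_trans (mnormX_dist n cL TL (mnorm_expm A))) //.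
  by rewrite ler_wpM2l // mulr_ge0 ?exprn_ge0.
have -> : expR (- s * n%:R) * (n%:R * L ^+ n * (c * expR (r * a) / r ^+ n))
    = c * expR (r * a) * (expR (- delta * n%:R) * (n%:R * rho ^+ n)).
  have -> : expR (- s * n%:R) = expR (- delta * n%:R) * expR (delta - s) ^+ n.
    by rewrite -expRM_natr -expRD; congr expR; ring.
  by rewrite /rho !exprMn exprVn; ring.
rewrite ler_wpM2l ?mulr_ge0 ?expR_ge0 // ler_piMr ?expR_ge0 //.
exact: natrM_exprn_le1.
Qed.

Lemma decays_mx V (N : 'M[R]_m.+1) delta :
  (forall i, decays N delta (col i V)) ->
  exists2 C, 0 <= C & forall n,
    mnorm (expm (n%:R *: N) *m V) <= C * expR (- delta * n%:R).
Proof.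
(* One constant is chosen for each column; their sum serves for all. *)
move=> Vd; have [C HC] := choice (fun i => let: ex_intro2 C C0 H := Vd i in
  ex_intro (fun C => 0 <= C /\ forall n j, `|(expm (n%:R *: N) *m col i V) j 0|
    <= C * expR (- delta * n%:R)) C (conj C0 H)).
have C0 i : 0 <= C i by case: (HC i).
exists (m.+1%:R * \sum_i C i); first by rewrite mulr_ge0 ?sumr_ge0.
move=> n; rewrite -mulrA; apply: mnorm_le_entries => j i.
have -> : (expm (n%:R *: N) *m V) j i = (expm (n%:R *: N) *m col i V) j 0.
  by rewrite !mxE; apply: eq_bigr => k _; rewrite mxE.
rewrite (le_trans ((HC i).2 _ _)) // ler_wpM2r ?expR_ge0 //.
by rewrite (bigD1 i) //= lerDl sumr_ge0.
Qed.

End Iteration.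

(** * Asymptotics of the iteration for a dominant real eigenvalue *)

Section PerronLike.
Variables (R : realType) (m : nat) (A : 'M[R]_m.+1) (delta : R) (V : 'M[R]_m.+1).
Let s := spectral_abscissa A.
Hypothesis s_spec : spectrum A (real_complex R s).
Hypothesis delta_gt0 : 0 < delta.
Hypothesis gap : forall mu : R[i], spectrum A mu -> mu != real_complex R s ->
  complex.Re mu <= s - 2 * delta.
Hypothesis V_unit : V \in unitmx.
Hypothesis V_norm1 : mnorm V = 1.

Let N := A - s%:M.
(** The degree in [t] of the polynomial [expm (t *: N) *m Y]. *)
Let p := (Cord A s).-1.
Let Y := mx_of_cols (yvec A V).
Let w := mx_of_cols (wvec A V).

Let Np x : GE_real A s x -> N ^+ p.+1 *m x = 0.
Proof. by have [nu0 NE _] := Cord_spec s_spec; rewrite /p prednK //; exact: NE. Qed.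

Lemma nilpotent_Y : N ^+ p.+1 *m Y = 0.
Proof.
rewrite mul_mx_of_cols; apply/matrixP => i j; rewrite !mxE.
have [/Np yE _] := Pi1_spec (col j V) s_spec.
by move/matrixP: yE => /(_ i 0); rewrite !mxE.
Qed.

Lemma wE : w = (p`!%:R)^-1 *: (N ^+ p *m Y).
Proof. by rewrite mul_mx_of_cols mx_of_colsZ. Qed.

Lemma complement_decays : exists2 C, 0 <= C & forall n,
  mnorm (expm (n%:R *: N) *m (V - Y)) <= C * expR (- delta * n%:R).
Proof.
apply: decays_mx => i; apply: E2_decays => //.
rewrite linearB /= col_mx_of_cols.
by have [] := Pi1_spec (col i V) s_spec.
Qed.

(* Write [x] in [E1] with [N ^ p x <> 0] as [V c]: the leading terms of
   [expm (n N) x] and [expm (n N) Y c] agree, because the difference decays. *)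
Lemma w_neq0 : w != 0.
Proof.
have [_ _ [x xs xp]] := Cord_spec s_spec; rewrite -/s -/N -/p in xp.
apply: contraNneq xp => w0.
pose X : 'M[R]_m.+1 := mx_of_cols (fun=> x).
pose c := invmx V *m X.
have NX : N ^+ p.+1 *m X = 0.
  rewrite mul_mx_of_cols (Np xs).
  by apply/matrixP => i j; rewrite !mxE.
have NYc : N ^+ p.+1 *m (Y *m c) = 0 by rewrite mulmxA nilpotent_Y mul0mx.
(* If [w] vanishes, then [n^(-p) e^(nN) Y c] is [O(1/n)]. *)
have NYc0 : (p`!%:R)^-1 *: (N ^+ p *m (Y *m c)) = 0.
  by rewrite mulmxA scalemxAl -wE w0 mul0mx.
have XE : X = Y *m c + (V - Y) *m c.
  by rewrite -mulmxDl addrC subrK mulmxA mulmxV // mul1mx.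
have [C C0 HC] := expm_leading_term NX.
have [C' C'0 HC'] := expm_leading_term NYc.
have [D D0 HD] := complement_decays.
set wX := (p`!%:R)^-1 *: (N ^+ p *m X) in HC.
have wX_le n : (1 <= n)%N -> mnorm wX <= (C + C' + D * mnorm c / delta) / n%:R.
  move=> n1; have n0 : 0 < n%:R :> R by rewrite ltr0n.
  have {}HC := HC n n1; have {}HC' := HC' n n1; rewrite NYc0 subr0 in HC'.
  rewrite XE mulmxDr scalerDr in HC.
  set a := _^-1 *: (_ *m (Y *m c)) in HC HC'.
  set b := _^-1 *: (_ *m ((V - Y) *m c)) in HC.
  have b_le : mnorm b <= D * mnorm c / delta / n%:R.
    rewrite /b mnormZ mulmxA ger0_norm ?invr_ge0 ?exprn_ge0 //.
    apply: (@le_trans _ _ (1 * (D * expR (- delta * n%:R) * mnorm c))).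
      apply: ler_pM; rewrite ?invr_ge0 ?exprn_ge0 ?mnorm_ge0 //.
        by rewrite invf_le1 ?exprn_gt0 // exprn_ege1 // ler1n.
      by rewrite (le_trans (mnormM _ _)) // ler_wpM2r ?mnorm_ge0.
    rewrite mul1r mulrAC -[leRHS]mulrA ler_wpM2l ?mulr_ge0 ?mnorm_ge0 //.
    (* From [1 + x <= e^x] at [x = delta n], the exponential is at most [1 / (delta n)]. *)
    rewrite -invfM mulNr expRN lef_pV2 ?posrE ?expR_gt0 ?mulr_gt0 //.
    by rewrite (le_trans _ (expR_ge1Dx _)) // lerDr.
  have : mnorm wX <= mnorm (a + b - wX) + (mnorm a + mnorm b).
    rewrite -[wX in leLHS](subKr (a + b)).
    by rewrite (le_trans (mnormB _ _)) // addrC lerD2l mnormD.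
  rewrite mulrDl mulrDl; lra.
(* [wX] does not depend on [n], so its [O(1/n)] bound makes it 0, against the choice of [x]. *)
suff wX0 : mnorm wX <= 0.
  have : wX == 0 by rewrite -mnorm_eq0 eq_le wX0 mnorm_ge0.
  rewrite /wX scaler_eq0 invr_eq0 pnatr_eq0 gtn_eqF ?fact_gt0 //=.
  rewrite mul_mx_of_cols => /eqP/matrixP X0.
  by apply/eqP/matrixP => i j; have := X0 i 0; rewrite !mxE ord1.
set K := C + C' + _ in wX_le.
have K0 : K / n.+1%:R @[n --> \oo] --> K * 0.
  by apply: cvgM; [exact: cvg_cst | exact: cvg_harmonic].
rewrite mulr0 in K0.
apply: (cvgr_to_ge K0); near=> n; exact: wX_le.
Unshelve. all: by end_near. Qed.

(** The positive factor disappears in the normalization; it makes the matrix comparable with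
    [expm (n%:R *: N) *m V]. *)
Lemma WE n : W A V n
  = nml (expR (- s * n%:R) *: (T A n ^+ n *m V)).
Proof. by rewrite nmlZ ?expR_gt0 // -iterM_nml. Qed.

Lemma expm_shift n : expm (n%:R *: N) = expR (- s * n%:R) *: expm A ^+ n.
Proof.
rewrite expm_natZ /N -raddfN /= expmDscalar exprZn; congr (_ *: _).
by rewrite -expRM_natr.
Qed.

(** Before normalization the two matrices differ by [(D + C) e^(-delta n)], and [nml_dist] applies
    once the second is bounded below. *)
Lemma W_q_dist : exists2 B, 0 < B & forall n,
  mnorm (W A V n - q A V n%:R) <= B * expR (- delta * n%:R).
Proof.
have [D D0 HD] := taylor_pow_dist A s delta.
have [C C0 HC] := complement_decays.
have [G G0 HG] := expm_leading_term nilpotent_Y; rewrite -wE in HG.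
have w_gt0 : 0 < mnorm w by rewrite mnorm_gt0 w_neq0.
(* From [n0] on, [G / n] is at most half of [mnorm w]. *)
pose n0 := (Num.truncn (2 * G / mnorm w)).+1.
have n0_ge : 2 * G / mnorm w <= n0%:R by rewrite ltW // truncnS_gt.
(* The first summand serves for [n >= n0]; for [n < n0] the second one dominates the trivial bound
   2. *)
exists (4 * (D + C) / mnorm w + 2 * expR (delta * n0%:R)).
  by rewrite ltr_wpDl ?mulr_gt0 ?expR_gt0 // !mulr_ge0 ?addr_ge0 ?invr_ge0 ?mnorm_ge0.
move=> n; rewrite mulrDl; have [n0n|nn0] := leqP n0 n; last first.
  rewrite ler_wpDl //.
    by rewrite !mulr_ge0 ?addr_ge0 ?invr_ge0 ?mnorm_ge0 ?expR_ge0.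
  apply: (@le_trans _ _ 2).
    rewrite q_nml WE (le_trans (mnormB _ _)) //.
    by rewrite (_ : 2 = 1 + 1) // lerD // mnorm_nml_le1.
  rewrite -mulrA ler_peMr // -expRD -[leLHS]expR0 ler_expR mulNr -mulrBr.
  by rewrite mulr_ge0 ?(ltW delta_gt0) // subr_ge0 ler_nat ltnW.
rewrite ler_wpDr ?mulr_ge0 ?expR_ge0 //.
set Q := expm (n%:R *: N) *m Y.
have n1 : (1 <= n)%N by exact: leq_trans n0n.
have nR : 0 < n%:R :> R by rewrite ltr0n.
(* [n^(-p) Q] is within [G / n] of [w], and [n^p >= 1]. *)
have Q_ge : mnorm w / 2 <= mnorm Q.
  have := mnorm_ge_dist ((n%:R ^+ p)^-1 *: Q) w; have := HG n n1; rewrite -/Q.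
  have : G / n%:R <= mnorm w / 2.
    rewrite ler_pdivrMr // mulrC -ler_pdivrMr ?divr_gt0 //.
    rewrite invf_div mulrCA mulrA (le_trans n0_ge) // ler_nat //.
  have : mnorm ((n%:R ^+ p)^-1 *: Q) <= mnorm Q.
    rewrite mnormZ ger0_norm ?invr_ge0 ?exprn_ge0 // ler_piMl ?mnorm_ge0 //.
    by rewrite invf_le1 ?exprn_gt0 // exprn_ege1 // ler1n.
  rewrite ler_norml => h1 h2 h3 /andP[h4 _]; lra.
have Q_gt0 : 0 < mnorm Q by rewrite (lt_le_trans _ Q_ge) // divr_gt0.
have Q0 : Q != 0 by rewrite -mnorm_gt0.
rewrite q_nml WE -/s -/N -/Y -/Q (le_trans (nml_dist _ Q0)) //.
have dist : mnorm (expR (- s * n%:R) *: (T A n ^+ n *m V) - Q)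
    <= (D + C) * expR (- delta * n%:R).
  (* The error is split into the Taylor remainder acting on [V] and the decaying part of [V] outside
     [E1]. *)
  have -> : expR (- s * n%:R) *: (T A n ^+ n *m V) - Q
      = expR (- s * n%:R) *: ((T A n ^+ n - expm A ^+ n) *m V)
        + expm (n%:R *: N) *m (V - Y).
    rewrite mulmxBr -/Q addrA; congr (_ - _).
    by rewrite expm_shift -scalemxAl mulmxBl scalerBr subrK.
  rewrite mulrDl (le_trans (mnormD _ _)) // lerD //.
  rewrite mnormZ ger0_norm ?expR_ge0 // (le_trans _ (HD n)) //.
  by rewrite ler_wpM2l ?expR_ge0 // (le_trans (mnormM _ _)) // V_norm1 mulr1.
rewrite ler_pdivrMr //.
apply: (@le_trans _ _ (2 * ((D + C) * expR (- delta * n%:R)))).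
  by rewrite ler_wpM2l.
have -> : 2 * ((D + C) * expR (- delta * n%:R))
    = 4 * (D + C) / mnorm w * expR (- delta * n%:R) * (mnorm w / 2).
  by field; rewrite gt_eqF.
by rewrite ler_wpM2l // !mulr_ge0 ?addr_ge0 ?invr_ge0 ?mnorm_ge0 ?expR_ge0.
Qed.

(** Dividing by [n^p] does not change the direction, and the quotient tends to [w] at rate [1/n]. *)
Lemma q_Xi_dist : exists2 C, 0 <= C & forall n, (1 <= n)%N ->
  mnorm (q A V n%:R - Xi A V) <= C / n%:R.
Proof.
have [G G0 HG] := expm_leading_term nilpotent_Y; rewrite -wE in HG.
exists (2 * G / mnorm w); first by rewrite !mulr_ge0 ?invr_ge0 ?mnorm_ge0.
move=> n n1; have n0 : 0 < n%:R :> R by rewrite ltr0n.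
rewrite q_nml Xi_nml -(@nmlZ _ _ (n%:R ^+ p)^-1) ?invr_gt0 ?exprn_gt0 //.
rewrite (le_trans (nml_dist _ w_neq0)) // [leRHS]mulrAC ler_wpM2r ?invr_ge0 ?mnorm_ge0 //.
by rewrite -mulrA ler_wpM2l // HG.
Qed.

(** [N w] is a multiple of [N^(p+1) Y = 0]. *)
Lemma mul_Xi : A *m Xi A V = s *: Xi A V.
Proof.
apply/eqP; rewrite -subr_eq0 -mul_scalar_mx -mulmxBl -/N Xi_nml -/w /nml wE.
by rewrite -!scalemxAr mulmxA -[N *m _]/(N * N ^+ p) -exprS nilpotent_Y !scaler0.
Qed.

(** [s] is the Rayleigh quotient at [Xi A V], of norm 1; the difference splits by bilinearity into
    two terms, each linear in [X - Xi A V]. *)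
Lemma rayleigh_Xi_dist X : mnorm X <= 1 ->
  `|mdot (A *m X) X - s| <= 2 * mnorm A * mnorm (X - Xi A V).
Proof.
move=> X1; have Xi1 : mnorm (Xi A V) = 1 by rewrite Xi_nml mnorm_nml // w_neq0.
have sE : s = mdot (A *m Xi A V) (Xi A V).
  by rewrite mul_Xi mdotZl -sqr_mnorm Xi1 expr1n mulr1.
have -> : mdot (A *m X) X - s = mdot (A *m (X - Xi A V)) X
    + mdot (A *m Xi A V) (X - Xi A V).
  by rewrite [in LHS]sE mulmxBr mdotBl mdotBr addrA subrK.
rewrite (le_trans (ler_normD _ _)) // -mulrA mulr_natl mulr2n lerD //.
  rewrite (le_trans (mdot_le _ _)) // -[leRHS]mulr1.
  by rewrite ler_pM ?mnorm_ge0 // mnormM.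
rewrite (le_trans (mdot_le _ _)) // ler_wpM2r ?mnorm_ge0 //.
by rewrite (le_trans (mnormM _ _)) // Xi1 mulr1.
Qed.

End PerronLike.

Lemma O_inv_n_harmonic (R : realType) (C : R) : 0 <= C -> O_inv_n (fun n => C / n%:R).
Proof.
(* The constant has to be positive, while [C] may be 0. *)
move=> C0; exists (C + 1); split=> [|n n1]; first by rewrite ltr_wpDl.
by rewrite ger0_norm ?divr_ge0 // ler_wpM2r ?invr_ge0 // lerDl.
Qed.

Theorem theorem5p1 (R : realType) :
  exists o : nat -> R, (o n @[n --> \oo] --> (0 : R)) /\
  forall (m : nat) (A : 'M[R]_m) (delta : R) (V : 'M[R]_m),
  let s := spectral_abscissa A in
  perron_like A ->
  0 < delta ->
  (forall mu : R[i], spectrum A mu -> mu != real_complex R s ->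
     complex.Re mu <= s - 2 * delta) ->
  V \in unitmx ->
  mnorm V = 1 ->
  exists B0 B1 B2 : R, [/\ 0 < B0, 0 < B1, 0 < B2 &
  exists r1 r2 : nat -> R, [/\ O_inv_n r1, O_inv_n r2 &
  forall n : nat, W_defined A V n ->
    mnorm (W A V n - q A V n%:R)
      <= B0 * expR (- delta * n%:R)
         + (lambda A * mnorm A / n.+1%:R) ^+ n.+1 * o n
    /\ ((1 <= n)%N ->
        mnorm (W A V n - Xi A V)
          <= r1 n + B1 * expR (- delta * n%:R)
             + (lambda A * mnorm A / n.+1%:R) ^+ n.+1 * o n
        /\ `|mdot (A *m W A V n) (W A V n) - s|
          <= r2 n + B2 * expR (- delta * n%:R)
             + mnorm A * (lambda A * mnorm A / n.+1%:R) ^+ n.+1 * o n)]].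
Proof.
exists (fun=> 0); split; first exact: cvg_cst.
move=> [|m] A delta V s [s_spec _] delta_gt0 gap V_unit V_norm1.
  (* In dimension 0 the norm of [V] cannot be 1. *)
  have V0 : V = 0 by apply/matrixP => i; have := ltn_ord i.
  by move/eqP: V_norm1; rewrite V0 mnorm0 eq_sym oner_eq0.
have [B B_gt0 HB] := W_q_dist s_spec delta_gt0 gap V_unit V_norm1.
have [C C0 HC] := q_Xi_dist s_spec delta_gt0 gap V_unit.
pose a := 2 * mnorm A; have a0 : 0 <= a by rewrite mulr_ge0 ?mnorm_ge0.
(* The summand 1 keeps the last constant positive when [A = 0]. *)
exists B, B, (a * B + 1); split => //; first by rewrite ltr_wpDl // mulr_ge0 // ltW.
exists (fun n => C / n%:R), (fun n => a * C / n%:R); split.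
- exact: O_inv_n_harmonic.
- by apply: O_inv_n_harmonic; rewrite mulr_ge0.
move=> n _; rewrite !mulr0 !addr0; split; first exact: HB.
move=> n1; have WXi : mnorm (W A V n - Xi A V)
    <= C / n%:R + B * expR (- delta * n%:R).
  by rewrite (le_trans (mnorm_distD (q A V n%:R) _ _)) // addrC lerD ?HC ?HB.
split => //.
have W1 : mnorm (W A V n) <= 1 by rewrite WE // mnorm_nml_le1.
rewrite (le_trans (rayleigh_Xi_dist s_spec delta_gt0 gap V_unit W1)) // -/a.
rewrite (le_trans (ler_wpM2l a0 WXi)) // mulrDr !mulrA lerD2l mulrDl mul1r.
by rewrite lerDl expR_ge0.
Qed.
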